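(* For any covering orientation $\mathbb{O} = (n, \mathbb{O}^+, \mathbb{O}^-)$, that is, with $\mathbb{O}^+, \mathbb{O}^- \subseteq [n]$ and $\{2, \dots, n-1\} \subseteq \mathbb{O}^+ \cup \mathbb{O}^-$, the set $\mathsf{PEP}(\mathbb{O})$ of permutree element posets induces a sublattice of the weak order lattice $(\mathcal{P}(n), \preccurlyeq, \wedge_{\mathcal{T}}, \vee_{\mathcal{T}})$ on posets on $[n]$.
   Context: Weak order on posets. $[n] = \{1,\dots,n\}$; $\mathcal{P}(n)$ is the set of (reflexive) posets on $[n]$. For a reflexive relation $R \subseteq [n]^2$ let $R^{\mathsf{Inc}} = \{(a,b)\in R : a\le b\}$, $R^{\mathsf{Dec}} = \{(b,a)\in R : a\le b\}$, and let $R^{\mathsf{tc}}$ be its transitive closure. Put $R \preccurlyeq S$ iff $R^{\mathsf{Inc}} \supseteq S^{\mathsf{Inc}}$ and $R^{\mathsf{Dec}} \subseteq S^{\mathsf{Dec}}$. Write $u \mathrel{R} v$ for $(u,v)\in R$. Define $R^{\mathsf{tdd}} = R \smallsetminus \{(b,a) \in R^{\mathsf{Dec}} : \exists\, i \le b,\ j \ge a \text{ with } i \mathrel{R} b \mathrel{R} a \mathrel{R} j \text{ and not } i \mathrel{R} j\}$ and $R^{\mathsf{tid}} = R \smallsetminus \{(a,b) \in R^{\mathsf{Inc}} : \exists\, i \ge a,\ j \le b \text{ with } i \mathrel{R} a \mathrel{R} b \mathrel{R} j \text{ and not } i \mathrel{R} j\}$. The weak order on $\mathcal{P}(n)$ is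 a lattice with meet $R \wedge_{\mathcal{T}} S = \big((R^{\mathsf{Inc}} \cup S^{\mathsf{Inc}})^{\mathsf{tc}} \cup (R^{\mathsf{Dec}} \cap S^{\mathsf{Dec}})\big)^{\mathsf{tdd}}$ and join $R \vee_{\mathcal{T}} S = \big((R^{\mathsf{Inc}} \cap S^{\mathsf{Inc}}) \cup (R^{\mathsf{Dec}} \cup S^{\mathsf{Dec}})^{\mathsf{tc}}\big)^{\mathsf{tid}}$. A subset induces a sublattice if it is closed under this meet and join. Permutrees. An orientation $\mathbb{O} = (n, \mathbb{O}^+, \mathbb{O}^-)$ consists of subsets $\mathbb{O}^+, \mathbb{O}^- \subseteq [n]$ (possibly empty, possibly intersecting). An $\mathbb{O}$-permutree is a directed tree $T$ with nodes bijectively labeled by (and identified with) $[n]$ such that each node $v$ has two parent slots (left and right) if $v \in \mathbb{O}^+$ and one parent slot otherwise, and two child slots (left and right) if $v \in \mathbb{O}^-$ and one child slot otherwise; each slot is either empty or contains exactly one neighbor (parents are outgoing neighbors, children are incoming neighbors); and if $v$ has two parent (resp. child) slots, all labels in the left ancestor (resp. descendant) subtree of $v$ (the connected component of $T \smallsetminus v$ attached through the left slot) are smaller than $v$ and all labels in the right one are larger than $v$. Let $i \vartriangleleft_T j$ iff there is a directed path (possibly of length $0$) from $i$ to $j$ in $T$. Then $\mathsf{PEP}(\mathbb{O}) = \{{\vartriangleleft_T} : T \text{ an } \mathbb{O}\text{-permutree}\}$. *)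

(* Defs.v *)
From mathcomp Require Import all_boot.

Set Implicit Arguments.
Unset Strict Implicit.
Unset Printing Implicit Defensive.

(* The label v of [n] = {1, ..., n} is represented by the ordinal v - 1 : 'I_n. *)

Section WeakOrder.

Variable n : nat.

Definition relation_on := {set 'I_n * 'I_n}.

Implicit Types R S : relation_on.

Definition is_poset R : Prop :=
  let r := [rel u v | (u, v) \in R] in
  [/\ reflexive r, antisymmetric r & transitive r].

Definition Inc R : relation_on := [set p in R | p.1 <= p.2].

Definition Dec R : relation_on := [set p in R | p.2 <= p.1].

(* [connect] is the reflexive transitive closure, so a first step is required. *)
Definition tc R : relation_on :=
  [set p | [exists z, ((p.1, z) \in R)
                      && connect [rel u v | (u, v) \in R] z p.2]].

Definition weak_le R S : bool := (Inc S \subset Inc R) && (Dec R \subset Dec S).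

Definition tdd R : relation_on :=
  R :\: [set p in Dec R |
          let: (b, a) := p in
          [exists i : 'I_n, exists j : 'I_n,
            [&& i <= b, a <= j,
                (i, b) \in R, (b, a) \in R, (a, j) \in R & (i, j) \notin R]]].

Definition tid R : relation_on :=
  R :\: [set p in Inc R |
          let: (a, b) := p in
          [exists i : 'I_n, exists j : 'I_n,
            [&& a <= i, j <= b,
                (i, a) \in R, (a, b) \in R, (b, j) \in R & (i, j) \notin R]]].

Definition meetT R S : relation_on :=
  tdd (tc (Inc R :|: Inc S) :|: (Dec R :&: Dec S)).

Definition joinT R S : relation_on :=
  tid ((Inc R :&: Inc S) :|: tc (Dec R :|: Dec S)).

Definition induces_sublattice (X : relation_on -> Prop) : Prop :=
  [/\ forall R, X R -> is_poset R,
      forall R S, X R -> X S -> X (meetT R S)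
    & forall R S, X R -> X S -> X (joinT R S)].

End WeakOrder.

Section WeakOrderLattice.

Variable n : nat.

Implicit Types R S T U : relation_on n.

(* Together, the lemmas on [weak_le] below and the lemmas [meetT_poset],
   [meetT_glb], [joinT_poset], [joinT_lub] state that the posets on [n] form a
   lattice under the weak order, with meet [meetT] and join [joinT]. *)

Lemma weak_le_refl R : weak_le R R.
Proof. by rewrite /weak_le !subxx. Qed.

Lemma weak_le_anti R S : weak_le R S -> weak_le S R -> R = S.
Proof.
have RID T : T = Inc T :|: Dec T.
  by apply/setP => -[u v]; rewrite !inE -andb_orr leq_total andbT.
move=> /andP[h1 h2] /andP[h3 h4]; rewrite (RID R) (RID S).
by congr (_ :|: _); apply/eqP; rewrite eqEsubset ?h1 ?h2 ?h3 ?h4.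
Qed.

Lemma weak_le_trans S R T : weak_le R S -> weak_le S T -> weak_le R T.
Proof.
move=> /andP[h1 h2] /andP[h3 h4].
by rewrite /weak_le (subset_trans h3 h1) (subset_trans h2 h4).
Qed.

Lemma is_posetP R :
  is_poset R <->
  [/\ forall u, (u, u) \in R,
      forall u v, (u, v) \in R -> (v, u) \in R -> u = v
    & forall v u w, (u, v) \in R -> (v, w) \in R -> (u, w) \in R].
Proof.
split=> -[rR aR tR]; split=> //.
- by move=> u v uv vu; apply: aR; rewrite /= uv vu.
- by move=> u v; move/andP=> -[uv vu]; apply: aR.
Qed.

Lemma in_Inc R u v : ((u, v) \in Inc R) = ((u, v) \in R) && (u <= v).
Proof. by rewrite inE. Qed.

Lemma in_Dec R u v : ((u, v) \in Dec R) = ((u, v) \in R) && (v <= u).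
Proof. by rewrite inE. Qed.

Lemma in_tdd R b a :
  reflect ((b, a) \in R /\
           (a <= b -> forall i j : 'I_n, i <= b -> a <= j ->
              (i, b) \in R -> (a, j) \in R -> (i, j) \in R))
          ((b, a) \in tdd R).
Proof.
rewrite !inE /=; case baR: ((b, a) \in R); rewrite ?andbF; last by right; case.
rewrite /= andbT; case: (leqP a b) => [le_ab|] /=; last by left.
apply: (iffP idP) => [nex|[_ H]].
  split=> // _ i j ib aj iR jR; apply: contraNT nex => nij.
  by apply/existsP; exists i; apply/existsP; exists j; rewrite ib aj iR jR.
apply/negP => /existsP[i /existsP[j /and5P[ib aj iR jR]]].
by rewrite H.
Qed.

Definition opp R : relation_on n := [set p | (p.2, p.1) \in R].

Lemma in_opp R u v : ((u, v) \in opp R) = ((v, u) \in R).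
Proof. by rewrite inE. Qed.

Lemma oppK R : opp (opp R) = R.
Proof. by apply/setP => -[u v]; rewrite !in_opp. Qed.

Lemma opp_poset R : is_poset R -> is_poset (opp R).
Proof.
move/is_posetP => [rR aR tR]; apply/is_posetP; split=> [u|u v|v u w];
  rewrite !in_opp //; first by move=> uv vu; apply: aR.
by move=> vu wv; apply: tR wv vu.
Qed.

Lemma opp_weak_le R S : weak_le (opp R) (opp S) = weak_le S R.
Proof.
have IO U u v : ((u, v) \in Inc (opp U)) = ((v, u) \in Dec U).
  by rewrite in_Inc in_Dec in_opp.
have DO U u v : ((u, v) \in Dec (opp U)) = ((v, u) \in Inc U).
  by rewrite in_Inc in_Dec in_opp.
apply/andP/andP => -[/subsetP h1 /subsetP h2]; split; apply/subsetP => -[u v].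
- by rewrite -!DO; apply: h2.
- by rewrite -!IO; apply: h1.
- by rewrite !IO; apply: h2.
- by rewrite !DO; apply: h1.
Qed.

Lemma tcP U u v : (forall x, (x, x) \in U) ->
  ((u, v) \in tc U) = connect [rel x y | (x, y) \in U] u v.
Proof.
move=> rU; rewrite inE /=; apply/existsP/idP => [[z /andP[uz zv]]|uv].
  exact: connect_trans (connect1 uz) zv.
by exists u; rewrite rU.
Qed.

Lemma tc_ind U (rU : forall x, (x, x) \in U) (P : 'I_n -> Prop) u v :
  (u, v) \in tc U -> (forall x y, (x, y) \in U -> P y -> P x) -> P v -> P u.
Proof.
rewrite tcP // => /connectP[p]; elim: p u => [|x p IH] u /=.
  by move=> _ ->.
by move=> /andP[ux px] lv H Pv; apply: (H _ x) => //; apply: IH.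
Qed.

Lemma tc_opp U : (forall x, (x, x) \in U) -> tc (opp U) = opp (tc U).
Proof.
move=> rU; apply/setP => -[u v].
rewrite in_opp !tcP // => [|x]; last by rewrite in_opp.
have /= <- := connect_rev [rel x y | (x, y) \in U] u v.
by apply: eq_connect => x y /=; rewrite in_opp.
Qed.

Lemma tdd_opp R : tdd (opp R) = opp (tid R).
Proof.
apply/setP => -[b a]; rewrite !inE /=; congr (~~ (_ && _) && _).
apply/existsP/existsP => -[i /existsP[j /and5P[h1 h2 h3 h4 /andP[h5 h6]]]];
  exists j; apply/existsP; exists i; move: h1 h2 h3 h4 h5 h6;
  by rewrite !inE /= => -> -> -> -> -> ->.
Qed.

Lemma joinT_opp R S : is_poset R -> is_poset S ->
  joinT R S = opp (meetT (opp R) (opp S)).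
Proof.
move=> /is_posetP[rR _ _] /is_posetP[rS _ _]; rewrite /meetT /joinT.
have -> : Inc (opp R) :|: Inc (opp S) = opp (Dec R :|: Dec S).
  by apply/setP => -[u v]; rewrite !inE.
have -> : Dec (opp R) :&: Dec (opp S) = opp (Inc R :&: Inc S).
  by apply/setP => -[u v]; rewrite !inE.
rewrite tc_opp => [|x]; last by rewrite !inE rR /= leqnn.
have -> A B : opp A :|: opp B = opp (B :|: A).
  by apply/setP => -[u v]; rewrite !inE orbC.
by rewrite tdd_opp oppK.
Qed.

Section Meet.

Variables (R S : relation_on n).
Hypotheses (pR : is_poset R) (pS : is_poset S).

Let U := Inc R :|: Inc S.
Let A := tc U.
Let D := Dec R :&: Dec S.
Let M0 := A :|: D.

Let rR : forall u, (u, u) \in R. Proof. by case/is_posetP: pR. Qed.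
Let rS : forall u, (u, u) \in S. Proof. by case/is_posetP: pS. Qed.

Let rU x : (x, x) \in U. Proof. by rewrite !inE rR leqnn. Qed.

Let AU x y : (x, y) \in U -> (x, y) \in A.
Proof. by move=> xy; rewrite tcP //; apply: connect1. Qed.

Let rA x : (x, x) \in A. Proof. exact: AU. Qed.

Let tA y x z : (x, y) \in A -> (y, z) \in A -> (x, z) \in A.
Proof. by rewrite !tcP //; apply: connect_trans. Qed.

Let Ule x y : (x, y) \in U -> x <= y.
Proof. by rewrite !inE /= => /orP[]/andP[]. Qed.

Let Ale x y : (x, y) \in A -> x <= y.
Proof.
move=> xy; apply: (tc_ind rU (P := fun x : 'I_n => x <= y) xy) => // a b ab.
by apply: leq_trans; apply: Ule.
Qed.

Let tD y x z : (x, y) \in D -> (y, z) \in D -> (x, z) \in D.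
Proof.
case/is_posetP: pR pS => _ _ tR /is_posetP[_ _ tS].
rewrite !in_setI !in_Dec => /andP[/andP[h1 l1] /andP[h2 _]].
move=> /andP[/andP[h3 l3] /andP[h4 _]].
by rewrite (tR y) // (tS y) // (leq_trans l3 l1).
Qed.

Let M0A (x y : 'I_n) : x <= y -> ((x, y) \in M0) = ((x, y) \in A).
Proof.
move=> xy; rewrite in_setU; case: (boolP ((x, y) \in A)) => //= nA.
apply/negP; rewrite in_setI in_Dec => /andP[/andP[_ yx] _].
by case/negP: nA; have -> : x = y by apply/val_inj/eqP; rewrite eqn_leq xy.
Qed.

Let M0D (x y : 'I_n) : y < x -> ((x, y) \in M0) = ((x, y) \in D).
Proof.
move=> yx; rewrite in_setU; case: (boolP ((x, y) \in A)) => //= /Ale.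
by rewrite leqNgt yx.
Qed.

Let MA (x y : 'I_n) : x <= y -> ((x, y) \in meetT R S) = ((x, y) \in A).
Proof.
move=> xy; rewrite -M0A //; apply/in_tdd/idP => [[]//|h]; split=> // yx i j.
have e : y = x by apply/val_inj/eqP; rewrite eqn_leq xy yx.
rewrite -/U -/A -/D -/M0 e => ix xj; rewrite !M0A ?(leq_trans ix xj) //.
exact: tA.
Qed.

Let MD x y : (x, y) \in meetT R S ->
  (x, y) \in M0 /\ (forall i j : 'I_n, (i, x) \in A -> (y, j) \in A ->
     (i, j) \in M0).
Proof.
move=> xyM; case/in_tdd: (xyM); rewrite -/U -/A -/D -/M0 => xy H.
split=> // i j ix yj; case: (leqP y x) => [yx|/ltnW xley].
  by apply: H => //; rewrite ?Ale // M0A ?Ale.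
have xyA : (x, y) \in A by rewrite -M0A.
by rewrite in_setU (tA (tA ix xyA) yj).
Qed.

Let MDV x y : (x, y) \in M0 -> (forall i j : 'I_n, (i, x) \in A ->
     (y, j) \in A -> (i, j) \in M0) -> (x, y) \in meetT R S.
Proof.
move=> xy H; apply/in_tdd; split=> // _ i j ix yj; rewrite -/U -/A -/D -/M0.
by move=> ixM yjM; apply: H; rewrite -M0A.
Qed.

Lemma meetT_poset : is_poset (meetT R S).
Proof.
have tM v u w : (u, v) \in meetT R S -> (v, w) \in meetT R S ->
    (u, w) \in meetT R S.
  move=> uvM vwM; have [uv Huv] := MD uvM; have [vw Hvw] := MD vwM.
  have M0AD x y : (x, y) \in M0 -> (x, y) \in A \/ (x, y) \in D.
    by rewrite in_setU => /orP.
  have AM0 x y : (x, y) \in A -> (x, y) \in M0 by rewrite in_setU => ->.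
  have DM0 x y : (x, y) \in D -> (x, y) \in M0.
    by rewrite in_setU => ->; rewrite orbT.
  case: (M0AD _ _ uv) => [uvA|uvD].
    by apply: MDV => [|i j iu wj]; apply: Hvw => //; apply: tA uvA.
  case: (M0AD _ _ vw) => [vwA|vwD].
    by apply: MDV => [|i j iu wj]; apply: Huv => //; apply: tA wj.
  apply: MDV => [|i j iu wj]; first exact: DM0 (tD uvD vwD).
  case: (M0AD _ _ (Huv i v iu (rA v))) => [iv|iv]; first exact: Hvw.
  case: (M0AD _ _ (Hvw v j (rA v) wj)) => [vj|vj]; first exact: Huv.
  exact: DM0 (tD iv vj).
have aM (u v : 'I_n) : u < v -> (u, v) \in meetT R S -> (v, u) \in meetT R S -> False.
  move=> uv; rewrite MA ?(ltnW uv) // => uvA /MD[vuM0 H].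
  have vuD : (v, u) \in D by rewrite -M0D.
  have nU (x : 'I_n) : x < v -> (v, x) \in D -> (x, v) \in U -> False.
    case/is_posetP: pR pS => _ aR _ /is_posetP[_ aS _] xv.
    rewrite in_setI !in_Dec => /andP[/andP[h1 _] /andP[h2 _]].
    rewrite in_setU !in_Inc => /orP[]/andP[h3 _].
      by move: xv; rewrite (aR _ _ h1 h3) ltnn.
    by move: xv; rewrite (aS _ _ h2 h3) ltnn.
  suff : (u, u) \in A -> u = v by move/(_ (rA u)) => e; rewrite e ltnn in uv.
  apply: (tc_ind rU (P := fun x => (u, x) \in A -> x = v) uvA) => // x y xyU IH.
  move=> ux; have yv := IH (tA ux (AU xyU)); rewrite yv in xyU.
  case: (ltngtP x v) => [xv||/val_inj//]; last by rewrite ltnNge (Ule xyU).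
  by case: (nU x xv) => //; rewrite -M0D //; apply: H.
apply/is_posetP; split=> // [u|u v uv vu]; first by rewrite MA.
by case: (ltngtP u v) => [h|h|/val_inj//]; case: (aM _ _ h).
Qed.

Lemma meetT_glb T : is_poset T ->
  weak_le T (meetT R S) = weak_le T R && weak_le T S.
Proof.
move=> pT; have [rT _ tT] := (is_posetP T).1 pT.
have [_ _ tR] := (is_posetP R).1 pR; have [_ _ tS] := (is_posetP S).1 pS.
apply/andP/andP => [[/subsetP h1 /subsetP h2]|].
  have h2' p : p \in Dec T -> p \in D.
    case: p => x y /h2; rewrite in_Dec => /andP[/MD[xy _] yx].
    move: xy; rewrite in_setU => /orP[/Ale xy|//].
    have -> : x = y by apply/val_inj/eqP; rewrite eqn_leq xy.
    by rewrite in_setI !in_Dec rR rS leqnn.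
  split; apply/andP; split; apply/subsetP => -[x y].
  - rewrite in_Inc => /andP[xy l]; apply: h1.
    by rewrite in_Inc l MA // AU // in_setU in_Inc xy l.
  - by move/h2'; rewrite in_setI => /andP[].
  - rewrite in_Inc => /andP[xy l]; apply: h1.
    by rewrite in_Inc l MA // AU // in_setU !in_Inc xy l orbT.
  - by move/h2'; rewrite in_setI => /andP[].
case=> /andP[/subsetP h1 /subsetP h2] /andP[/subsetP h3 /subsetP h4].
have UT x y : (x, y) \in U -> (x, y) \in T.
  by rewrite in_setU => /orP[/h1|/h3]; rewrite in_Inc => /andP[].
have AT x y : (x, y) \in A -> (x, y) \in T.
  move=> xy; apply: (tc_ind rU (P := fun x => (x, y) \in T) xy) => // a b ab.
  by apply: tT; apply: UT.
have DT x y : (x, y) \in T -> y < x -> (x, y) \in D.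
  by move=> xy /ltnW l; rewrite in_setI h2 ?h4 // in_Dec xy l.
have DRS x y : (x, y) \in D -> (x, y) \in R /\ (x, y) \in S.
  by rewrite in_setI !in_Dec => /andP[/andP[-> _] /andP[-> _]].
have stepL z x y : (z, x) \in U -> (x, y) \in M0 -> (x, y) \in T ->
    (z, y) \in M0.
  move=> zx xy xyT; case: (leqP x y) => [l|l].
    by rewrite in_setU (tA (AU zx)) // -M0A.
  have [xyR xyS] : (x, y) \in R /\ (x, y) \in S by apply: DRS; rewrite -M0D.
  case: (leqP z y) => [zy|yz]; last first.
    by rewrite in_setU (DT z y) ?orbT //; apply: tT (UT _ _ zx) xyT.
  rewrite in_setU AU // in_setU !in_Inc zy !andbT.
  move: zx; rewrite in_setU !in_Inc => /orP[]/andP[zx _].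
    by rewrite (tR _ _ _ zx xyR).
  by rewrite (tS _ _ _ zx xyS) orbT.
have stepR z x y : (y, z) \in U -> (x, y) \in M0 -> (x, y) \in T ->
    (x, z) \in M0.
  move=> yz xy xyT; case: (leqP x y) => [l|l].
    by rewrite in_setU (tA _ (AU yz)) // -M0A.
  have [xyR xyS] : (x, y) \in R /\ (x, y) \in S by apply: DRS; rewrite -M0D.
  case: (leqP x z) => [xz|zx]; last first.
    by rewrite in_setU (DT x z) ?orbT //; apply: tT xyT (UT _ _ yz).
  rewrite in_setU AU // in_setU !in_Inc xz !andbT.
  move: yz; rewrite in_setU !in_Inc => /orP[]/andP[yz _].
    by rewrite (tR _ _ _ xyR yz).
  by rewrite (tS _ _ _ xyS yz) orbT.
split; apply/subsetP => -[x y].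
  rewrite in_Inc => /andP[xy l]; rewrite in_Inc l andbT.
  by apply: AT; rewrite -MA.
rewrite in_Dec => /andP[xy l].
have xyM0 : (x, y) \in M0.
  case: (ltngtP y x) => [yx||/val_inj e]; last by rewrite e in_setU rA.
    by rewrite in_setU (DT x y) ?orbT.
  by rewrite ltnNge l.
rewrite in_Dec l andbT; apply: MDV => // i j ix yj.
have [iy iyT] : (i, y) \in M0 /\ (i, y) \in T.
  apply: (tc_ind rU (P := fun i => (i, y) \in M0 /\ (i, y) \in T) ix) => //.
  move=> a b ab [h5 h6]; split; first exact: stepL ab h5 h6.
  exact: tT (UT _ _ ab) h6.
pose P y := (i, y) \in M0 -> (i, y) \in T -> (i, j) \in M0.
apply: (tc_ind rU (P := P) yj) => // a b ab IH h5 h6.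
by apply: IH; [apply: stepR ab h5 h6 | apply: tT h6 (UT _ _ ab)].
Qed.

End Meet.

Lemma joinT_poset R S : is_poset R -> is_poset S -> is_poset (joinT R S).
Proof.
by move=> pR pS; rewrite joinT_opp //; apply/opp_poset/meetT_poset;
  apply: opp_poset.
Qed.

Lemma joinT_lub R S T : is_poset R -> is_poset S -> is_poset T ->
  weak_le (joinT R S) T = weak_le R T && weak_le S T.
Proof.
move=> pR pS pT; rewrite joinT_opp // -{1}(oppK T) opp_weak_le.
by rewrite meetT_glb ?opp_weak_le //; apply: opp_poset.
Qed.

End WeakOrderLattice.

Section Permutrees.

Variable n : nat.

Record orientation := Orientation {
  Oplus : {set 'I_n};
  Ominus : {set 'I_n}
}.

(* The ordinals with 0 < v and v.+1 < n represent the labels 2, ..., n - 1. *)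
Definition covering (O : orientation) : Prop :=
  forall v : 'I_n, 0 < v -> v.+1 < n -> v \in Oplus O :|: Ominus O.

Definition adjacent (e : rel 'I_n) : rel 'I_n := [rel u v | e u v || e v u].

(* Asymmetry excludes loops and pairs of opposite edges; the last clause
   excludes the remaining cycles of the underlying undirected graph. *)
Definition directed_tree (e : rel 'I_n) : Prop :=
  [/\ forall u v, e u v -> ~~ e v u,
      forall u v, connect (adjacent e) u v
    & forall c : seq 'I_n, 2 < size c -> ~ ucycle (adjacent e) c].

(* The connected component containing u of the tree with v removed. *)
Definition branch (e : rel 'I_n) (v u : 'I_n) : {set 'I_n} :=
  [set w | connect [rel x y | [&& adjacent e x y, x != v & y != v]] u w].

Inductive slot := Left | Right | Middle.

Definition has_slot (two : bool) (s : slot) : bool :=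
  if s is Middle then ~~ two else two.

(* [edge u v] means that v is a parent of u. If [edge v u], then
   [parent_slot v u] is the parent slot of v containing u; if [edge u v], then
   [child_slot v u] is the child slot of v containing u. The values of these
   functions on other pairs are irrelevant. *)
Record permutree (O : orientation) := Permutree {
  edge : rel 'I_n;
  parent_slot : 'I_n -> 'I_n -> slot;
  child_slot : 'I_n -> 'I_n -> slot;
  edge_tree : directed_tree edge;
  parent_slotP : forall v u,
    edge v u -> has_slot (v \in Oplus O) (parent_slot v u);
  child_slotP : forall v u,
    edge u v -> has_slot (v \in Ominus O) (child_slot v u);
  parent_slot_inj : forall v u u',
    edge v u -> edge v u' -> parent_slot v u = parent_slot v u' -> u = u';
  child_slot_inj : forall v u u',
    edge u v -> edge u' v -> child_slot v u = child_slot v u' -> u = u';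
  left_ancestors : forall v u, edge v u -> parent_slot v u = Left ->
    forall w, w \in branch edge v u -> w < v;
  right_ancestors : forall v u, edge v u -> parent_slot v u = Right ->
    forall w, w \in branch edge v u -> v < w;
  left_descendants : forall v u, edge u v -> child_slot v u = Left ->
    forall w, w \in branch edge v u -> w < v;
  right_descendants : forall v u, edge u v -> child_slot v u = Right ->
    forall w, w \in branch edge v u -> v < w
}.

Definition tree_order (O : orientation) (T : permutree O) : relation_on n :=
  [set p | connect (edge T) p.1 p.2].

Definition PEP (O : orientation) (R : relation_on n) : Prop :=
  exists T : permutree O, R = tree_order T.

End Permutrees.

(* Main.v *)
Require Import Defs.
From mathcomp Require Import all_boot.
From mathcomp Require Import zify.

Set Implicit Arguments.
Unset Strict Implicit.
Unset Printing Implicit Defensive.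

(* A poset R is in PEP(O) iff it satisfies two local conditions. Convexity: if
   a < b < c and a, c are comparable in R, then b is R-below the R-greater of them
   when b is in O^-, and R-above the R-smaller when b is in O^+. Separation: if
   a < c are incomparable, then some increasing relation of R inside [a, c] is incompatible,
   by convexity, with adding (c, a).
   In a permutree, both follow by looking at the first turns of the simple path
   between two nodes. Conversely, the tree is the Hasse diagram of R: its turns
   have their two neighbours on opposite sides, so that a path never comes back
   after a turn, which gives both acyclicity and the slot conditions.
   Both conditions pass to the meet; as O is covering, every label strictly
   between two others is in O^+ or in O^-, so convexity always says something.
   Reversing the edges of permutrees exchanges O^+ with O^- and meet with join. *)

(** * Local conditions on a relation, stated for both directions at once *)

Section Characterization.

Variable n : nat.
Implicit Types (O : orientation n) (R S : relation_on n) (e : rel 'I_n).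
Implicit Types a b c i j u v w x y z : 'I_n.

(* [d = true] reads relations upwards and looks at parents, [d = false] reads
   them downwards and looks at children. *)
Definition dir (d : bool) e : rel 'I_n := fun u v => if d then e u v else e v u.

Definition rdir d R : rel 'I_n := dir d (fun u v => (u, v) \in R).

Definition Odir d O : {set 'I_n} := if d then Oplus O else Ominus O.

Definition between (x b z : 'I_n) : bool := (x < b < z) || (z < b < x).

Definition convex O R : Prop := forall d b x z,
  b \in Odir d O -> between x b z -> rdir d R x z -> rdir d R x b.

(* The three alternatives are exactly the ways in which the increasing relations
   of a convex poset can forbid the decreasing relation (c, a). *)
Definition blocked O (r : rel 'I_n) (a c : 'I_n) : Prop :=
  [\/ exists b : 'I_n, [/\ a < b, b < c, b \in Ominus O & r a b],
      exists b : 'I_n, [/\ a < b, b < c, b \in Oplus O & r b c]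
    | exists x y : 'I_n, [/\ [/\ a < x, x < y & y < c], x \in Oplus O,
        y \in Ominus O & r x y]].

Definition separated O R : Prop := forall a c : 'I_n,
  a < c -> (a, c) \notin R -> (c, a) \notin R ->
  blocked O (fun u v => (u, v) \in R) a c.

Definition PEP_axioms O R := [/\ is_poset R, convex O R & separated O R].

Lemma dirN d e u v : dir (~~ d) e u v = dir d e v u.
Proof. by case: d. Qed.

Lemma adjacent_dir d e u v : adjacent e u v = dir d e u v || dir (~~ d) e u v.
Proof. by case: d; rewrite // [RHS]orbC. Qed.

Lemma adjacentC e u v : adjacent e u v = adjacent e v u.
Proof. exact: orbC. Qed.

Lemma connect_dir d e u v : connect (dir d e) u v = dir d (connect e) u v.
Proof. by case: d; first by []; rewrite /dir connect_rev. Qed.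

Lemma branch_root e v u : u \in branch e v u.
Proof. by rewrite inE connect0. Qed.

Lemma branch_step e v u x y : x \in branch e v u -> adjacent e x y ->
  x != v -> y != v -> y \in branch e v u.
Proof.
rewrite !inE => h xy xv yv; apply: connect_trans h (connect1 _).
by rewrite /= xv yv !andbT.
Qed.

(** A simple path leaving [v] through [u] never meets [v] again, so it stays in one component. *)
Lemma branch_path e v u p : path (adjacent e) v (u :: p) ->
  uniq (v :: u :: p) -> last u p \in branch e v u.
Proof.
move=> /= /andP[_ hp] /andP[]; rewrite inE negb_or => /andP[vu vp] _.
elim/last_ind: p hp vp => [|p x IH]; first by rewrite branch_root.
rewrite rcons_path last_rcons mem_rcons inE negb_or => /andP[hp ax].
move=> /andP[vx vp]; apply: (branch_step (IH hp vp) ax); last by rewrite eq_sym.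
have := mem_last u p; rewrite inE => /orP[/eqP->|h]; first by rewrite eq_sym.
by apply: contraNneq vp => <-.
Qed.

(** * Permutree orders are convex and separated *)

Section FromPermutree.

Variables (O : orientation n) (T : permutree O).
Notation e := (edge T).

(** As [v] has two slots in direction [d], [u] fills the left or the right one, and its whole branch
    lies on that side of [v]. *)
Lemma dir_edge_sides d v u w w' : v \in Odir d O -> dir d e v u ->
  w \in branch e v u -> w' \in branch e v u -> ~~ between w v w'.
Proof.
move=> vO vu wu w'u; rewrite /between.
case: d vO vu => /= vO vu.
- have := parent_slotP vu; rewrite vO; case E: (parent_slot _ _ _) => // _.
  + have := left_ancestors vu E wu; have := left_ancestors vu E w'u; lia.
  + have := right_ancestors vu E wu; have := right_ancestors vu E w'u; lia.
- have := child_slotP vu; rewrite vO; case E: (child_slot _ _ _) => // _.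
  + have := left_descendants vu E wu; have := left_descendants vu E w'u; lia.
  + have := right_descendants vu E wu; have := right_descendants vu E w'u; lia.
Qed.

(** Distinct neighbours in the same direction fill distinct slots, which must be the left and the
    right one. *)
Lemma dir_edge_fork d v u u' w w' : dir d e v u -> dir d e v u' -> u != u' ->
  w \in branch e v u -> w' \in branch e v u' ->
  v \in Odir d O /\ between w v w'.
Proof.
move=> vu vu' ne wu w'u; rewrite /between; case: d vu vu' => /= vu vu'.
- have I : parent_slot T v u <> parent_slot T v u'.
    by move/(parent_slot_inj vu vu')/eqP; rewrite (negPf ne).
  have := parent_slotP vu; have := parent_slotP vu'; move: I.
  case: (v \in Oplus O);
  case E: (parent_slot T v u); case E': (parent_slot T v u') => // _ _ _; split => //.
  + have := left_ancestors vu E wu; have := right_ancestors vu' E' w'u; lia.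
  + have := right_ancestors vu E wu; have := left_ancestors vu' E' w'u; lia.
- have I : child_slot T v u <> child_slot T v u'.
    by move/(child_slot_inj vu vu')/eqP; rewrite (negPf ne).
  have := child_slotP vu; have := child_slotP vu'; move: I.
  case: (v \in Ominus O);
  case E: (child_slot T v u); case E': (child_slot T v u') => // _ _ _; split => //.
  + have := left_descendants vu E wu; have := right_descendants vu' E' w'u; lia.
  + have := right_descendants vu E wu; have := left_descendants vu' E' w'u; lia.
Qed.

Lemma tree_order_poset : is_poset (tree_order T).
Proof.
case: (edge_tree T) => asym _ acyc.
apply/is_posetP; split=> [u|u v|v u w]; rewrite !inE /=.
- exact: connect0.
- case/connectP => -[_ -> //|w p] /= /andP[uw pw] lv vu.
  have : connect e w u.
    by apply: connect_trans vu; apply/connectP; exists p.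
  case/connectP => q0 pq0; case/shortenP: pq0 => q wq uq _ lq.
  case: (acyc (w :: q)).
    (* Asymmetry excludes closed paths with one or two nodes; a longer one is a cycle of the
       underlying graph. *)
    case: q wq uq lq => [|x [|y q]] //=.
    - by move=> _ _ eu; move: (asym _ _ uw); rewrite eu in uw *; rewrite uw.
    - by rewrite andbT => wx _ eu; rewrite eu in uw; rewrite (negPf (asym _ _ uw)) in wx.
  rewrite /ucycle uq andbT /cycle rcons_path -lq.
  have sub : subrel e (adjacent e) by move=> x y xy; apply/orP; left.
  by rewrite /= [adjacent e u w]sub //= (sub_path sub wq).
- exact: connect_trans.
Qed.

Lemma simple_path u v : u != v ->
  exists w p, [/\ path (adjacent e) u (w :: p), uniq (u :: w :: p) & last w p = v].
Proof.
move=> ne; case: (edge_tree T) => _ /(_ u v) /connectP[q pq lq] _.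
move: lq; case/shortenP: pq => -[|w p] // => [_ _ _ /= E|pp up _ ->].
  by rewrite E eqxx in ne.
by exists w, p.
Qed.

(* [y] is the first turn of the path, [v'] and [v] are its neighbours before and
   after the turn. *)
Lemma first_turn d b u p : path (adjacent e) b (u :: p) -> uniq (b :: u :: p) ->
  dir d e b u -> connect (dir d e) b (last u p) \/
  exists y v v' q, [/\ [/\ connect (dir d e) b y, y \in u :: p &
      b \in branch e y v'],
    [/\ dir (~~ d) e y v, dir (~~ d) e y v' & v' != v],
    path (adjacent e) y (v :: q), uniq (y :: v :: q) & last v q = last u p].
Proof.
elim: p b u => [|u2 p IH] b u; first by move=> _ _ bu; left; apply: connect1.
move=> Hp Hu bu.
have Hp' : path (adjacent e) u (u2 :: p) by case/andP: Hp.
have Hu' : uniq (u :: u2 :: p) by case/andP: Hu.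
have abu : adjacent e b u by case/andP: Hp.
have bn : b \notin u :: u2 :: p by case/andP: Hu.
have un : u \notin u2 :: p by case/andP: Hu'.
have : adjacent e u u2 by case/andP: Hp'.
rewrite (adjacent_dir d) => /orP[uu2|uu2].
  case: (IH u u2 Hp' Hu' uu2) => [h|]; first by left; apply: connect_trans (connect1 bu) h.
  move=> [y [v [v' [q [[uy yin uv'] h2 h3 h4 h5]]]]]; right; exists y, v, v', q; split=> //.
  split; first exact: connect_trans (connect1 bu) uy.
    by rewrite inE yin orbT.
  apply: (branch_step uv'); rewrite 1?adjacentC //.
    by apply: contraNneq un => ->.
  by apply: contraNneq bn => ->; rewrite inE yin orbT.
right; exists u, u2, b, p; split=> //.
  by split; [apply: connect1 | rewrite inE eqxx | rewrite branch_root].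
split=> //; first by rewrite dirN.
by apply: contraNneq bn => ->; rewrite !inE eqxx orbT.
Qed.

Lemma tree_orderE d u v : rdir d (tree_order T) u v = connect (dir d e) u v.
Proof. by rewrite connect_dir /rdir; case: d; rewrite /dir inE. Qed.

(** A path can leave a branch at [y] only by passing through [y]. *)
Lemma branch_connect d x z y u : connect (dir d e) x z -> x != y ->
  x \in branch e y u -> connect (dir d e) x y \/ z \in branch e y u.
Proof.
case/connectP => p; elim/last_ind: p z => [|p w IH] z; first by move=> _ -> _; right.
rewrite rcons_path last_rcons => /andP[pp lw] -> xy xb.
case: (IH _ pp erefl xy xb) => [|h]; first by left.
case: (eqVneq (last x p) y) => [E|ny].
  by left; apply/connectP; exists p.
case: (eqVneq w y) => [E|nwy].
  left; rewrite -E; apply: (connect_trans (y := last x p)); last exact: connect1.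
  by apply/connectP; exists p.
by right; apply: (branch_step h) => //; rewrite (adjacent_dir d) lw.
Qed.

(** Consider the simple path from [b] to [x]. If it starts in direction [d], the directed path from
    [x] to [z] must meet [b], since a branch at [b] lies on one side of [b]. Otherwise either it
    runs straight to [x], or its first turn [y] separates [b] from [x]; the path from [x] to [z]
    then meets [y], as otherwise [x] and [z] would lie on the same side of [b]. *)
Lemma tree_order_convex : convex O (tree_order T).
Proof.
move=> d b x z bO btw; rewrite !tree_orderE => xz.
have bx : b != x by apply: contraTneq btw => ->; rewrite /between; lia.
case: (simple_path bx) => u [p [Hp Hu Hl]].
have : adjacent e b u by case/andP: Hp.
rewrite (adjacent_dir d) => /orP[bu|bu].
  have xb : x \in branch e b u by rewrite -Hl branch_path.
  case: (branch_connect xz _ xb) => //; first by rewrite eq_sym.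
  by move=> zb; move: (dir_edge_sides bO bu xb zb); rewrite btw.
case: (first_turn Hp Hu bu); rewrite Hl; first by rewrite !connect_dir dirN.
move=> [y [v [v' [q [[byc _ bb] [yv yv' ne] Hp' Hu' Hl']]]]].
have xb : x \in branch e y v by rewrite -Hl' branch_path.
move: byc; rewrite connect_dir dirN -connect_dir => byc.
case: (eqVneq x y) => [-> //|xy].
case: (branch_connect xz xy xb) => [h|zb]; first exact: connect_trans h byc.
have [_ h1] := dir_edge_fork yv' yv ne bb xb.
have [_ h2] := dir_edge_fork yv' yv ne bb zb.
move: btw h1 h2; rewrite /between; clear; lia.
Qed.

(** On the simple path from [a] to [c], an upward start followed by a turn gives the first
    alternative. After a downward start, the first turn [x] either climbs straight to [c], the
    second alternative, or climbs to another turn [y], the third. The forks at the turns give the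
    inequalities. *)
Lemma tree_order_separated : separated O (tree_order T).
Proof.
have E d u v := tree_orderE d u v.
move=> a c ac; rewrite !inE /= => nac nca.
have ne : a != c by apply: contraTneq ac => ->; rewrite ltnn.
case: (simple_path ne) => u [p [Hp Hu Hl]].
have : adjacent e a u by case/andP: Hp.
rewrite (adjacent_dir true) => /orP[au|au].
  case: (first_turn Hp Hu au); rewrite Hl; first by rewrite (negPf nac).
  move=> [y [v [v' [q [[ay _ ab] [yv yv' nv] Hp' Hu' Hl']]]]].
  have cb : c \in branch e y v by rewrite -Hl' branch_path.
  have [yO h] := dir_edge_fork yv' yv nv ab cb.
  by constructor 1; exists y; split; rewrite ?inE //; move: ac h; rewrite /between; clear; lia.
case: (first_turn Hp Hu au); rewrite Hl.
  by rewrite connect_dir /= (negPf nca).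
move=> [x [v [v' [q [[_ _ ab] [xv xv' nv] Hp' Hu' Hl']]]]].
have cb : c \in branch e x v by rewrite -Hl' branch_path.
have [xO] := dir_edge_fork xv' xv nv ab cb.
rewrite /between => h.
case: (first_turn Hp' Hu' xv); rewrite Hl' => xc.
  by constructor 2; exists x; split; rewrite ?inE //; move: ac h; clear; lia.
case: xc => y [w [w' [r [[xy _ xb] [yw yw' nw] Hp'' Hu'' Hl'']]]].
have cy : c \in branch e y w by rewrite -Hl'' branch_path.
have [yO h'] := dir_edge_fork yw' yw nw xb cy.
move: h'; rewrite /between => h'.
by constructor 3; exists x, y; split; rewrite ?inE //; move: ac h h'; clear=> *; split; lia.
Qed.

End FromPermutree.

(** * The Hasse diagram of a convex separated poset is a permutree *)

Section ToPermutree.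

Variables (O : orientation n) (R : relation_on n).
Hypotheses (pR : is_poset R) (convR : convex O R) (sepR : separated O R).

Lemma rdir_refl d u : rdir d R u u.
Proof. by case/is_posetP: pR => rR _ _; rewrite /rdir /dir; case: d. Qed.

Lemma rdir_anti d u v : rdir d R u v -> rdir d R v u -> u = v.
Proof.
by case/is_posetP: pR => _ aR _; rewrite /rdir /dir; case: d => *; apply: aR.
Qed.

Lemma rdir_trans d u v w : rdir d R u v -> rdir d R v w -> rdir d R u w.
Proof.
case/is_posetP: pR => _ _ tR; rewrite /rdir /dir.
by case: d => [uv vw|vu wv]; [apply: tR uv vw | apply: tR wv vu].
Qed.

Lemma rdirN d u v : rdir (~~ d) R u v = rdir d R v u.
Proof. exact: dirN. Qed.

Definition cover : rel 'I_n := fun u v =>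
  [&& u != v, (u, v) \in R &
    [forall w, ((u, w) \in R) ==> ((w, v) \in R) ==> (w == u) || (w == v)]].

Lemma dir_cover d u v : dir d cover u v ->
  [/\ u != v, rdir d R u v &
      forall w, rdir d R u w -> rdir d R w v -> w = u \/ w = v].
Proof.
rewrite /rdir /dir; case: d => /and3P[uv uvR /forallP H].
  split=> // w uw wv.
  by have := H w; rewrite uw wv => /orP[]/eqP->; auto.
split=> // [|w uw wv]; first by rewrite eq_sym.
by have := H w; rewrite uw wv => /orP[]/eqP->; auto.
Qed.

(** Induction on the size of the interval from [u] to [v]: a relation that is not a cover splits at
    an interior element into two strictly smaller intervals. *)
Lemma connect_cover u v : connect cover u v = ((u, v) \in R).
Proof.
have [rR aR tR] := (is_posetP R).1 pR.
apply/idP/idP.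
  case/connectP => p; elim: p u => [|w p IH] u /=; first by move=> _ ->.
  by move=> /andP[/and3P[_ uw _] wp] lv; apply: tR uw (IH _ wp lv).
pose I u v := [set w | ((u, w) \in R) && ((w, v) \in R)].
have [m] := ubnP #|I u v|; elim: m u v => // m IH u v lm uv.
case: (eqVneq u v) => [-> //|ne].
case: (boolP (cover u v)) => [/connect1 //|]; rewrite /cover ne uv /=.
case/forallPn => w; rewrite !negb_imply negb_or => /and4P[uw wv wu wv'].
apply: (connect_trans (y := w)); apply: IH => //; apply: leq_trans (proper_card _) lm.
  apply/properP; split.
    by apply/subsetP => x; rewrite !inE => /andP[-> xw]; apply: tR xw wv.
  exists v; rewrite !inE ?uv ?rR //=.
  by apply: contra wv' => vw; rewrite (aR _ _ vw wv).
apply/properP; split.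
  by apply/subsetP => x; rewrite !inE => /andP[wx ->]; rewrite andbT; apply: tR uw wx.
exists u; rewrite !inE ?uv ?rR ?andbT //=.
by apply: contra wu => wu; rewrite (aR _ _ wu uw).
Qed.

(* If both neighbours lay on the same side of [v], or [v] had a single slot, then
   by convexity none of the three reasons for [u] and [u'] to be incomparable
   could occur. *)
Lemma cover_fork_lt d v (u u' : 'I_n) : dir d cover v u -> dir d cover v u' ->
  u < u' -> v \in Odir d O /\ between u v u'.
Proof.
move=> /dir_cover[vu Rvu Cvu] /dir_cover[vu' Rvu' Cvu'] uu'.
have [/andP[]//|nF] := boolP ((v \in Odir d O) && between u v u').
have ne : u != u' by apply: contraTneq uu' => ->; rewrite ltnn.
have A x y : rdir d R x y -> rdir d R y x -> x = y by exact: rdir_anti.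
have nvu x : rdir d R x v -> x = u \/ x = u' -> False.
  move=> xv [] E; rewrite E in xv.
    by move: vu; rewrite (A _ _ xv Rvu) eqxx.
  by move: vu'; rewrite (A _ _ xv Rvu') eqxx.
have n1 : rdir d R u u' -> False.
  move=> h; case: (Cvu' _ Rvu h) => E; first by rewrite E eqxx in vu.
  by rewrite E eqxx in ne.
have n2 : rdir d R u' u -> False.
  move=> h; case: (Cvu _ Rvu' h) => E; first by rewrite E eqxx in vu'.
  by rewrite E eqxx in ne.
have btw (b : 'I_n) : u < b -> b < u' -> b != v -> between v b u \/ between v b u'.
  move=> h1 h2; rewrite neq_ltn /between => /orP[] h3; [left|right];
    by rewrite h3 ?h1 ?h2 ?orbT.
(* [nF] excludes [b = v]; any other label between [u] and [u'] also lies between [v] and one of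
   them, so convexity applies to that cover. *)
have F1 (b : 'I_n) : u < b -> b < u' -> b \in Odir d O -> b != v /\ rdir d R v b.
  move=> h1 h2 bO.
  have bv : b != v.
    by apply: contraNneq nF => <-; rewrite bO /between h1 h2.
  by split=> //; case: (btw b h1 h2 bv) => h; apply: convR bO h _.
have F2 (b : 'I_n) : u < b -> b < u' -> b \in Odir (~~ d) O -> b != v ->
    rdir d R b u \/ rdir d R b u'.
  move=> h1 h2 bO bv.
  case: (btw b h1 h2 bv) => h; [left|right]; rewrite -rdirN.
    by apply: (convR (x := u) (z := v)); rewrite ?rdirN // /between orbC.
  by apply: (convR (x := u') (z := v)); rewrite ?rdirN // /between orbC.
have nR x y : x = u /\ y = u' \/ x = u' /\ y = u -> (x, y) \notin R.
  move=> E; apply/negP => h; have : rdir d R x y \/ rdir d R y x.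
    by rewrite /rdir /dir; case: (d); auto.
  by move: E => [] [-> ->] [].
have := sepR uu' (nR u u' (or_introl (conj erefl erefl)))
  (nR u' u (or_intror (conj erefl erefl))).
have gtN (x y : 'I_n) : x < y -> x <> y by move=> h E; rewrite E ltnn in h.
(* Three alternatives and two directions. Each case ends with an element strictly inside a cover,
   with [u] and [u'] comparable, or with a failure of antisymmetry. *)
case=> [[b [h1 h2 bO ub]]|[b [h1 h2 bO bu]]|[x [y [[h1 h2 h3] xO yO xy]]]];
  case: d Rvu Cvu Rvu' Cvu' nF A nvu n1 n2 F1 F2 {nR}
  => Rvu Cvu Rvu' Cvu' _ A nvu n1 n2 F1 F2; exfalso.
- case: (eqVneq b v) => [E|bv].
    by apply: (nvu u); rewrite ?E in ub *; auto.
  case: (F2 b h1 h2 bO bv) => h; last by apply: n1; apply: rdir_trans h.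
  by apply: (gtN _ _ h1); apply: A.
- have [bv h] := F1 b h1 h2 bO.
  case: (Cvu b h ub) => E; first by rewrite E eqxx in bv.
  by rewrite E ltnn in h1.
- have [bv h] := F1 b h1 h2 bO.
  case: (Cvu' b h bu) => E; first by rewrite E eqxx in bv.
  by rewrite E ltnn in h2.
- case: (eqVneq b v) => [E|bv].
    by apply: (nvu u'); rewrite ?E in bu *; auto.
  case: (F2 b h1 h2 bO bv) => h; first by apply: n2; apply: rdir_trans h.
  by apply: (gtN _ _ h2); apply: A.
- have [xv h] := F1 x h1 (ltn_trans h2 h3) xO.
  have yv : y != v.
    by apply: contra_neq xv => E; apply: A => //; rewrite -E.
  case: (F2 y (ltn_trans h1 h2) h3 yO yv) => h'.
    case: (Cvu x h (rdir_trans (xy : rdir true R x y) h')) => E.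
      by rewrite E eqxx in xv.
    by rewrite E ltnn in h1.
  case: (Cvu' x h (rdir_trans (xy : rdir true R x y) h')) => E.
    by rewrite E eqxx in xv.
  by have := ltn_trans h2 h3; rewrite E ltnn.
have [yv h] := F1 y (ltn_trans h1 h2) h3 yO.
have xv : x != v.
  by apply: contra_neq yv => E; apply: A => //; rewrite -E.
case: (F2 x h1 (ltn_trans h2 h3) xO xv) => h'.
  case: (Cvu y h (rdir_trans (xy : rdir false R y x) h')) => E.
    by rewrite E eqxx in yv.
  by have := ltn_trans h1 h2; rewrite E ltnn.
case: (Cvu' y h (rdir_trans (xy : rdir false R y x) h')) => E.
  by rewrite E eqxx in yv.
by rewrite E ltnn in h3.
Qed.

Lemma cover_fork d v u u' : dir d cover v u -> dir d cover v u' -> u != u' ->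
  v \in Odir d O /\ between u v u'.
Proof.
move=> vu vu'; rewrite neq_ltn => /orP[h|h]; first exact: cover_fork_lt vu vu' h.
by have [? ?] := cover_fork_lt vu' vu h; split; rewrite // /between orbC.
Qed.

Definition side (s : bool) (a b : 'I_n) : bool := if s then a < b else b < a.

(* After a turn at [t], convexity keeps each directed stretch on one side of [t],
   and the next turn has its two neighbours on opposite sides, so the path goes
   further away on the same side. *)
Lemma one_side s d t p c r : rdir d R t p -> dir d cover p c ->
  t \in Odir d O -> side s c t -> path (adjacent cover) p (c :: r) ->
  uniq (p :: c :: r) -> side s (last c r) t.
Proof.
elim: r d t p c => [//|x r IH] d t p c tp pc tO ct Hp Hu.
have [npc Rpc _] := dir_cover pc.
have tc := rdir_trans tp Rpc.
have Hp' : path (adjacent cover) c (x :: r) by case/andP: Hp.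
have Hu' : uniq (c :: x :: r) by case/andP: Hu.
have px : p != x.
  by apply: contraTneq Hu => ->; rewrite /= !inE eqxx orbT.
have ntc : c != t by apply: contraTneq ct => ->; rewrite /side ltnn if_same.
have : adjacent cover c x by case/andP: Hp'.
rewrite (adjacent_dir d) => /orP[cx|cx].
  have [_ Rcx _] := dir_cover cx.
  apply: (IH d t c x) => //.
  have nct : ~ rdir d R c t by move=> h; rewrite (rdir_anti tc h) eqxx in ntc.
  have xt : x != t by apply/eqP => E; apply: nct; rewrite -E.
  (* If the step from [c] to [x] crossed [t], convexity at [t] would relate [c] to [t]. *)
  apply/negPn/negP => nx; apply: nct; apply: convR tO _ Rcx.
  move: xt ct nx; rewrite /side /between neq_ltn; clear; case: s => /=; lia.
(* The path turns at [c]. Convexity at [c] puts [p] on the same side of [c] as [t], so [x] lies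
   beyond [c], and the induction restarts in the opposite direction with [c] in place of [t]. *)
have cp : dir (~~ d) cover c p by rewrite dirN.
have [cO btw] := cover_fork cp cx px.
have ncp : ~ rdir d R c p by move=> h; rewrite (rdir_anti Rpc h) eqxx in npc.
have sp : side s c p.
  case: (eqVneq p t) => [-> //|pt].
  apply/negPn/negP => np; apply: ncp; rewrite -rdirN.
  apply: (convR cO (z := t)); last by rewrite rdirN.
  move: npc pt ct np; rewrite /side /between !neq_ltn; clear; case: s => /=; lia.
have sx : side s x c.
  by move: sp btw; rewrite /side /between; clear; case: s => /=; lia.
have := IH (~~ d) c c x (rdir_refl _ _) cx cO sx Hp' Hu'.
move: ct; rewrite /side; clear; case: s => /=; lia.
Qed.

(** Induction on the difference of labels: for incomparable labels, separation supplies a comparable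
    pair inside the interval, which leaves only smaller gaps to join. *)
Lemma cover_connected u v : connect (adjacent cover) u v.
Proof.
have C (x y : 'I_n) : (x, y) \in R -> connect (adjacent cover) x y.
  rewrite -connect_cover; apply: connect_sub => a b ab.
  by apply: connect1; apply/orP; left.
have S x y : connect (adjacent cover) x y = connect (adjacent cover) y x.
  by apply: sym_connect_sym => a b; apply: adjacentC.
suff H m (x y : 'I_n) : y - x < m -> x < y -> connect (adjacent cover) x y.
  case: (ltngtP u v) => [h|h|/val_inj->]; last exact: connect0.
    exact: H (ltnSn _) h.
  by rewrite S; exact: H (ltnSn _) h.
elim: m x y => // m IH x y ym xy.
have [/C //|nxy] := boolP ((x, y) \in R).
have [h|nyx] := boolP ((y, x) \in R); first by rewrite S; apply: C.
have IH' (a b : 'I_n) : x <= a -> a < b -> b <= y -> b - a < y - x ->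
    connect (adjacent cover) a b.
  by move=> _ ab _ lt; apply: IH ab; apply: leq_trans lt _.
case: (sepR xy nxy nyx).
- move=> [b [h1 h2 _ xb]]; apply: connect_trans (C _ _ xb) _.
  by apply: IH' => //; move: h1 h2; clear; lia.
- move=> [b [h1 h2 _ by_]]; apply: connect_trans (C _ _ by_).
  by apply: IH' => //; move: h1 h2; clear; lia.
move=> [a [b [[h1 h2 h3] _ _ ab]]].
apply: (connect_trans (y := a)); first by apply: IH' => //; move: h1 h2 h3; clear; lia.
by apply: connect_trans (C _ _ ab) _; apply: IH' => //; move: h1 h2 h3; clear; lia.
Qed.

(* A minimal vertex of a cycle is a turn, with its two neighbours on opposite
   sides; but the rest of the cycle joins them staying on one side. *)
Lemma cover_acyclic (c : seq 'I_n) : 2 < size c -> ~ ucycle (adjacent cover) c.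
Proof.
have [rR aR tR] := (is_posetP R).1 pR.
move=> sc /andP[cc uc].
have [x0 x0c] : exists x, x \in c.
  by case: c sc {cc uc} => // x c' _; exists x; rewrite inE eqxx.
(* The smallest down-set belongs to an [R]-minimal vertex of the cycle, so both cycle neighbours of
   [v] cover it. *)
case: (arg_minnP (fun x => #|[set z | (z, x) \in R]|) x0c) => v vc vmin.
have up x : x \in c -> adjacent cover v x -> cover v x.
  move=> xc /orP[//|/and3P[xv xvR _]]; have := vmin x xc; rewrite leqNgt => /negP[].
  apply: proper_card; apply/properP; split.
    by apply/subsetP => z; rewrite !inE => zx; apply: tR zx xvR.
  exists v; rewrite !inE ?rR //; apply: contra xv => vx.
  by rewrite (aR _ _ vx xvR).
have [i p rc] := rot_to vc.
have mc x : x \in v :: p -> x \in c by rewrite -rc mem_rot.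
have cp : cycle (adjacent cover) (v :: p) by rewrite -rc rot_cycle.
have up' : uniq (v :: p) by rewrite -rc rot_uniq.
have sp : 2 < size (v :: p) by rewrite -rc size_rot.
case: p {rc} mc cp up' sp => [//|u p] mc cp up' sp.
have {cp} /andP[hp lv] : path (adjacent cover) v (u :: p) && adjacent cover (last u p) v.
  by move: cp; rewrite /cycle rcons_path.
have vu : cover v u.
  by apply: up; [apply: mc; rewrite !inE eqxx orbT | case/andP: hp].
have lin : last u p \in u :: p by apply: mem_last.
have vl : cover v (last u p).
  by apply: up; rewrite 1?adjacentC //; apply: mc; rewrite inE lin orbT.
have ne : u != last u p.
  case: p sp up' {hp lv mc lin vl} => // w p _ /= /and3P[_ h _].
  by apply: contraNneq h => ->; apply: mem_last.
have [vO btw] := cover_fork (d := true) vu vl ne.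
pose s : bool := u < v.
have su : side s u v.
  by move: btw; rewrite /side /s /between; case: ifP => //; clear; lia.
have := one_side (rdir_refl true v) (vu : dir true cover v u) vO su hp up'.
move: su btw; rewrite /side /between; clear; case: s => /=; lia.
Qed.

Lemma cover_directed_tree : directed_tree cover.
Proof.
split; [|exact: cover_connected|exact: cover_acyclic].
move=> u v /and3P[uv uvR _]; apply: contra uv => /and3P[_ vuR _].
by apply/eqP; apply: (rdir_anti (d := true)).
Qed.

(** Any node of the branch ends a simple path from [v] through [u], to which [one_side] applies with
    [t] and [p] both equal to [v]. *)
Lemma cover_branch_side s d v u w : v \in Odir d O -> dir d cover v u ->
  side s u v -> w \in branch cover v u -> side s w v.
Proof.
move=> vO vu uv; rewrite inE => /connectP[p0 pp0].
case/shortenP: pp0 => p pp up _ ->.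
have [ne _ _] := dir_cover vu.
apply: (one_side (rdir_refl d v) vu vO uv).
  rewrite /= -/(adjacent cover v u) (adjacent_dir d) vu /=.
  by apply: sub_path pp => x y /= /and3P[].
rewrite cons_uniq up andbT inE negb_or ne /=.
elim: p u pp {up vu uv ne} => //= x p IH u /andP[/and3P[_ _ xv] pp].
by rewrite inE negb_or eq_sym xv (IH _ pp).
Qed.

(** * Slots of the Hasse diagram and the resulting permutree *)

Definition cover_slot d (v u : 'I_n) : slot :=
  if v \in Odir d O then if u < v then Left else Right else Middle.

Lemma has_cover_slot d v u : has_slot (v \in Odir d O) (cover_slot d v u).
Proof. by rewrite /cover_slot; case: ifP => //; case: ifP. Qed.

Lemma cover_slot_inj d v u u' : dir d cover v u -> dir d cover v u' ->
  cover_slot d v u = cover_slot d v u' -> u = u'.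
Proof.
move=> vu vu' E; apply/eqP/negPn/negP => ne; move: E.
have [vO] := cover_fork vu vu' ne; rewrite /cover_slot vO /between.
by clear; case: ifP; case: ifP => //; lia.
Qed.

Lemma cover_slot_left d v u : dir d cover v u -> cover_slot d v u = Left ->
  forall w, w \in branch cover v u -> w < v.
Proof.
move=> vu; rewrite /cover_slot; case: ifP => // vO; case: ifP => // uv _ w.
exact: (cover_branch_side (s := true) vO vu).
Qed.

Lemma cover_slot_right d v u : dir d cover v u -> cover_slot d v u = Right ->
  forall w, w \in branch cover v u -> v < w.
Proof.
move=> vu; rewrite /cover_slot; case: ifP => // vO; case: ifP => // uv _ w.
apply: (cover_branch_side (s := false) vO vu).
have [vu' _ _] := dir_cover vu; move: vu' uv; rewrite /side neq_ltn /=; clear; lia.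
Qed.

Definition cover_permutree : permutree O := Permutree cover_directed_tree
  (fun v u _ => has_cover_slot true v u) (fun v u _ => has_cover_slot false v u)
  (@cover_slot_inj true) (@cover_slot_inj false)
  (@cover_slot_left true) (@cover_slot_right true)
  (@cover_slot_left false) (@cover_slot_right false).

Lemma tree_order_cover : tree_order cover_permutree = R.
Proof. by apply/setP => -[u v]; rewrite inE /= connect_cover. Qed.

End ToPermutree.

Lemma PEP_axiomsP O R : PEP O R <-> PEP_axioms O R.
Proof.
split=> [[T ->]|[pR cR sR]].
  by split; [apply: tree_order_poset | apply: tree_order_convex
            | apply: tree_order_separated].
by exists (cover_permutree pR cR sR); rewrite tree_order_cover.
Qed.

Lemma blocked_sub O (r r' : rel 'I_n) a c :
  subrel r r' -> blocked O r a c -> blocked O r' a c.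
Proof.
move=> sub [[b [h1 h2 bO h]]|[b [h1 h2 bO h]]|[x [y [h xO yO xy]]]].
- by constructor 1; exists b; split=> //; apply: sub.
- by constructor 2; exists b; split=> //; apply: sub.
- by constructor 3; exists x, y; split=> //; apply: sub.
Qed.

(** All quantifiers range over finitely many labels, which makes the later case split on [blocked]
    constructive. *)
Lemma blocked_dec O (r : rel 'I_n) a c : blocked O r a c \/ ~ blocked O r a c.
Proof.
case: (boolP [exists b : 'I_n, [&& a < b, b < c, b \in Ominus O & r a b]]) => [|n1].
  by case/existsP => b /and4P[*]; left; constructor 1; exists b.
case: (boolP [exists b : 'I_n, [&& a < b, b < c, b \in Oplus O & r b c]]) => [|n2].
  by case/existsP => b /and4P[*]; left; constructor 2; exists b.
case: (boolP [exists x : 'I_n, [exists y : 'I_n,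
    [&& [&& a < x, x < y & y < c], x \in Oplus O, y \in Ominus O & r x y]]]) => [|n3].
  case/existsP => x /existsP[y /and4P[/and3P[*] *]].
  by left; constructor 3; exists x, y.
right => -[[b [h1 h2 bO h]]|[b [h1 h2 bO h]]|[x [y [[h1 h2 h3] xO yO xy]]]].
- by case/existsP: n1; exists b; rewrite h1 h2 bO.
- by case/existsP: n2; exists b; rewrite h1 h2 bO.
- by case/existsP: n3; exists x; apply/existsP; exists y; rewrite h1 h2 h3 xO yO.
Qed.

(** * Closure under meet *)

Section Meet.

Variables (O : orientation n) (R S : relation_on n).
Hypothesis hO : covering O.
Hypotheses (axR : PEP_axioms O R) (axS : PEP_axioms O S).

Let U := Inc R :|: Inc S.
Let A : rel 'I_n := fun u v => (u, v) \in tc U.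
Let D : rel 'I_n := fun u v => ((u, v) \in R) && ((u, v) \in S).

Let M : relation_on n := meetT R S.

(** The covering hypothesis enters here: a label with others on both sides is not extreme. *)
Lemma interior (a x c : 'I_n) : a < x -> x < c -> x \in Oplus O \/ x \in Ominus O.
Proof.
move=> ax xc; apply/orP; rewrite -in_setU; apply: hO.
  exact: leq_ltn_trans ax.
exact: leq_ltn_trans xc (ltn_ord c).
Qed.

Let poset_refl (T : relation_on n) : is_poset T -> forall u, (u, u) \in T.
Proof. by case/is_posetP. Qed.

Let poset_anti (T : relation_on n) : is_poset T ->
  forall u v, (u, v) \in T -> (v, u) \in T -> u = v.
Proof. by case/is_posetP. Qed.

Let rU u : (u, u) \in U.
Proof. by case: axR => pR _ _; rewrite in_setU in_Inc leqnn poset_refl. Qed.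

Let UP x y : reflect (x <= y /\ ((x, y) \in R \/ (x, y) \in S)) ((x, y) \in U).
Proof.
rewrite in_setU !in_Inc -andb_orl andbC.
by apply: (iffP andP) => -[-> h]; split=> //; apply/orP.
Qed.

Let AU x y : (x, y) \in U -> A x y.
Proof. by move=> h; rewrite /A tcP //; apply: connect1. Qed.

Let A_refl x : A x x.
Proof. exact: AU. Qed.

Let A_trans y x z : A x y -> A y z -> A x z.
Proof. by rewrite /A !tcP //; apply: connect_trans. Qed.

Let A_ind (P : 'I_n -> Prop) u v : A u v ->
  (forall x y, (x, y) \in U -> A y v -> P y -> P x) -> P v -> P u.
Proof.
move=> uv H Pv; suff : A u v /\ P u by case.
apply: (tc_ind (P := fun x => A x v /\ P x) rU uv) => // x y xy [yv Py].
by split; [apply: A_trans (AU xy) yv | apply: H xy yv Py].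
Qed.

Let A_ind_r (P : 'I_n -> Prop) u v : A u v ->
  (forall x y, (x, y) \in U -> A u x -> P x -> P y) -> P u -> P v.
Proof.
move=> uv H Pu; pose Q x := A u x /\ P x -> P v.
suff : Q u by apply.
apply: (tc_ind (P := Q) rU uv) => [x y xy Qy [ux Px]|[]//]; apply: Qy.
by split; [apply: A_trans ux (AU xy) | apply: H xy ux Px].
Qed.

Let A_le (x y : 'I_n) : A x y -> x <= y.
Proof.
move=> xy; apply: (A_ind (P := fun x : 'I_n => x <= y) xy) => // a b /UP[ab _] _.
exact: leq_trans ab.
Qed.

Let M0 : rel 'I_n := fun x y => A x y || (y <= x) && D x y.

Let M0_lt (x y : 'I_n) : y < x -> M0 x y = D x y.
Proof.
move=> yx; rewrite /M0 (ltnW yx) /=.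
by case: (boolP (A x y)) => // /A_le; rewrite leqNgt yx.
Qed.

(** [M0] is the relation to which [tdd] is applied. The [tdd] condition only concerns decreasing
    pairs, but extends to all pairs because it holds for increasing ones by transitivity of [A]. *)
Let meetTP x y : (x, y) \in M <->
  M0 x y /\ forall i j : 'I_n, A i x -> A y j -> M0 i j.
Proof.
have E u v : ((u, v) \in tc U :|: Dec R :&: Dec S) = M0 u v.
  by rewrite in_setU in_setI !in_Dec andbACA andbb [in LHS]andbC.
have M0A (u v : 'I_n) : u <= v -> M0 u v -> A u v.
  rewrite leq_eqVlt => /orP[/eqP/val_inj-> //|uv /orP[//|]].
  by rewrite leqNgt uv.
split=> [/in_tdd[]|[xy H]].
  rewrite !E => xy H; split=> // i j ix yj; case: (leqP y x) => [yx|/ltnW yx].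
    by rewrite -E; apply: H => //; first [exact: A_le | rewrite E /M0 ?ix ?yj].
  by rewrite /M0 (A_trans ix (A_trans (M0A _ _ yx xy) yj)).
apply/in_tdd; rewrite !E; split=> // yx i j ix yj; rewrite !E.
by move=> /(M0A _ _ ix) ? /(M0A _ _ yj) ?; apply: H.
Qed.

Let AM x y : A x y -> (x, y) \in M.
Proof.
move=> xy; apply/meetTP; rewrite /M0 xy; split=> // i j ix yj.
by rewrite (A_trans ix (A_trans xy yj)).
Qed.

Let MA (x y : 'I_n) : x < y -> (x, y) \in M -> A x y.
Proof. by move=> xy /meetTP[/orP[//|]]; rewrite leqNgt xy. Qed.

Let convex4 (T : relation_on n) : convex O T -> forall a b c : 'I_n, a < b -> b < c ->
  [/\ b \in Ominus O -> (a, c) \in T -> (b, c) \in T,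
      b \in Oplus O -> (a, c) \in T -> (a, b) \in T,
      b \in Ominus O -> (c, a) \in T -> (b, a) \in T
    & b \in Oplus O -> (c, a) \in T -> (c, b) \in T].
Proof.
move=> cT a b c ab bc.
have h : between a b c by rewrite /between ab bc.
have h' : between c b a by rewrite /between ab bc orbT.
by split=> bO; [apply: (cT false) h' | apply: (cT true) h
               | apply: (cT false) h | apply: (cT true) h'].
Qed.

(** * Convexity of the meet *)

Let U_convex (a b c : 'I_n) : a < b -> b < c -> (a, c) \in U ->
  (b \in Ominus O -> (b, c) \in U) /\ (b \in Oplus O -> (a, b) \in U).
Proof.
move=> ab bc /UP[_ acU].
case: axR axS => _ /convex4/(_ _ _ _ ab bc)[r1 r2 _ _] _.
case=> _ /convex4/(_ _ _ _ ab bc)[s1 s2 _ _] _.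
by split=> bO; apply/UP; rewrite ?(ltnW ab) ?(ltnW bc); split=> //;
  case: acU; auto.
Qed.

(** The increasing chain from [a] to [c] visits [b] or has one step jumping over it; [U_convex] at
    that step links [b] to the rest of the chain. *)
Let A_convex_minus (a b c : 'I_n) : a < b -> b < c -> b \in Ominus O ->
  A a c -> A b c.
Proof.
move=> ab bc bO ac; move: ab.
apply: (A_ind (P := fun a : 'I_n => a < b -> A b c) ac) => [x y xy yc IH xb|].
  case: (ltngtP y b) => [|h|/val_inj <- //]; first exact: IH.
  by have [/(_ bO)/AU + _] := U_convex xb h xy; move/A_trans; apply.
by move/ltnW; rewrite leqNgt bc.
Qed.

Let A_convex_plus (a b c : 'I_n) : a < b -> b < c -> b \in Oplus O ->
  A a c -> A a b.
Proof.
move=> ab bc bO ac; move: bc.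
apply: (A_ind_r (P := fun c : 'I_n => b < c -> A a b) ac) => [x y xy ax IH xb|].
  case: (ltngtP b x) => [|h|/val_inj -> //]; first exact: IH.
  by have [_ /(_ bO)/AU] := U_convex h xb xy; apply: A_trans.
by move/ltnW; rewrite leqNgt ab.
Qed.

Let D_convex_minus (a b c : 'I_n) : a < b -> b < c -> b \in Ominus O ->
  D c a -> D b a.
Proof.
move=> ab bc bO /andP[caR caS]; apply/andP.
case: axR axS => _ /convex4/(_ _ _ _ ab bc)[_ _ r _] _.
by case=> _ /convex4/(_ _ _ _ ab bc)[_ _ s _] _; split; auto.
Qed.

Let D_convex_plus (a b c : 'I_n) : a < b -> b < c -> b \in Oplus O ->
  D c a -> D c b.
Proof.
move=> ab bc bO /andP[caR caS]; apply/andP.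
case: axR axS => _ /convex4/(_ _ _ _ ab bc)[_ _ _ r] _.
by case=> _ /convex4/(_ _ _ _ ab bc)[_ _ _ s] _; split; auto.
Qed.

Let UD (x y : 'I_n) : (x, y) \in U -> D y x -> x = y.
Proof.
move=> /UP[_ xy] /andP[yxR yxS].
case: axR axS => /poset_anti aR _ _ [/poset_anti aS _ _].
by case: xy => h; [apply: aR | apply: aS].
Qed.

Let M_convex_minus (a b c : 'I_n) : a < b -> b < c -> b \in Ominus O ->
  (c, a) \in M -> (b, a) \in M.
Proof.
move=> ab bc bO /meetTP[]; rewrite (M0_lt (ltn_trans ab bc)) => ca H.
(* Going down the chain from [b]: if [y] were in O^+ and the next node [z] in O^-, convexity would
   turn [D c a] into [D c y] and then [D z y], against the increasing step from [y] to [z]. *)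
have chain x : A x b -> a < x -> x \in Ominus O.
  move=> xb; apply: (A_ind (P := fun x : 'I_n => a < x -> x \in Ominus O) xb) => //.
  move=> y z yz zb IH ay; have [yz' _] := UP _ _ yz.
  have zO := IH (leq_trans ay yz').
  have zc : z < c := leq_ltn_trans (A_le zb) bc.
  have yc : y < c := leq_ltn_trans yz' zc.
  case: (interior ay yc) => // yO; move: yz'.
  rewrite leq_eqVlt => /orP[/eqP/val_inj-> //|yz'].
  have cy := D_convex_plus ay yc yO ca.
  by rewrite (UD yz (D_convex_minus yz' zc zO cy)).
(* The first proper step of such a chain would go from [a] to some [y] in O^-, while convexity gives
   [D y a]. *)
have nab : ~ A a b.
  move=> h; suff : a <> a by [].
  apply: (A_ind (P := fun x : 'I_n => x <> a) h) => [x y xy yb ya xa|E].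
    rewrite xa in xy; have [ay _] := UP _ _ xy.
    have ay' : a < y by rewrite ltn_neqAle ay andbT; apply/eqP => /val_inj E; case: ya.
    have yc : y < c := leq_ltn_trans (A_le yb) bc.
    by apply: ya; rewrite -(UD xy (D_convex_minus ay' yc (chain _ yb ay') ca)).
  by rewrite E ltnn in ab.
apply/meetTP; split=> [|i j ib aj].
  by rewrite M0_lt //; apply: D_convex_minus bc bO ca.
have ic : i < c := leq_ltn_trans (A_le ib) bc.
(* If [a < i], then [i] is in O^- by [chain] and convexity at [i] applies. If [i < a], then [a] is
   interior: O^- contradicts [nab], and O^+ gives a chain from [i] through [a] to [j]. *)
case: (ltngtP a i) => [ai|ia|/val_inj <-]; last by rewrite /M0 aj.
  have iO := chain _ ib ai.
  case: (ltngtP j i) => [ji|ij|/val_inj ->]; last by rewrite /M0 A_refl.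
    have := H c j (A_refl c) aj; rewrite !M0_lt // ?(ltn_trans ji) //.
    exact: D_convex_minus.
  by rewrite /M0 (A_convex_minus ai ij).
case: (interior ia ab) => aO; last by case: nab; apply: A_convex_minus ia ab aO ib.
by rewrite /M0 (A_trans (A_convex_plus ia ab aO ib) aj).
Qed.

(** Mirror image of [M_convex_minus]: the chain now climbs from [b] and its nodes below [c] stay in
    O^+. *)
Let M_convex_plus (a b c : 'I_n) : a < b -> b < c -> b \in Oplus O ->
  (c, a) \in M -> (c, b) \in M.
Proof.
move=> ab bc bO /meetTP[]; rewrite (M0_lt (ltn_trans ab bc)) => ca H.
have chain x : A b x -> x < c -> x \in Oplus O.
  move=> bx; apply: (A_ind_r (P := fun x : 'I_n => x < c -> x \in Oplus O) bx) => //.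
  move=> z y zy bz IH yc; have [zy' _] := UP _ _ zy.
  have zO := IH (leq_ltn_trans zy' yc).
  have az : a < z := leq_trans ab (A_le bz).
  have ay : a < y := leq_trans az zy'.
  case: (interior ay yc) => // yO; move: zy'.
  rewrite leq_eqVlt => /orP[/eqP/val_inj<- //|zy'].
  have ya := D_convex_minus ay yc yO ca.
  by rewrite -(UD zy (D_convex_plus az zy' zO ya)).
have nbc : ~ A b c.
  move=> h; suff : c <> c by [].
  apply: (A_ind_r (P := fun x : 'I_n => x <> c) h) => [x y xy bx xc yc|E].
    rewrite yc in xy; have [xc' _] := UP _ _ xy.
    have xc'' : x < c by rewrite ltn_neqAle xc' andbT; apply/eqP => /val_inj.
    have ax : a < x := leq_trans ab (A_le bx).
    by apply: xc; apply: (UD xy (D_convex_plus ax xc'' (chain _ bx xc'') ca)).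
  by rewrite E ltnn in bc.
apply/meetTP; split=> [|i j ic bj].
  by rewrite M0_lt //; apply: D_convex_plus ab _ bO ca.
have aj : a < j := leq_trans ab (A_le bj).
case: (ltngtP j c) => [jc|cj|/val_inj ->]; last by rewrite /M0 ic.
  have jO := chain _ bj jc.
  case: (ltngtP j i) => [ji|ij|/val_inj ->]; last by rewrite /M0 A_refl.
    have := H i a ic (A_refl a); rewrite !M0_lt // ?(ltn_trans aj) //.
    exact: D_convex_plus.
  by rewrite /M0 (A_convex_plus ij jc).
case: (interior bc cj) => cO; first by case: nbc; apply: A_convex_plus bc cj cO bj.
by rewrite /M0 (A_trans ic (A_convex_minus bc cj cO bj)).
Qed.

Lemma meetT_convex : convex O M.
Proof.
move=> d b x z bO /orP[/andP[xb bz]|/andP[zb bx]]; rewrite /rdir /dir; case: d bO => bO xz.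
- by apply/AM/(A_convex_plus xb bz bO)/MA => //; apply: ltn_trans bz.
- exact: M_convex_minus bz bO xz.
- exact: M_convex_plus zb bx bO xz.
- by apply/AM/(A_convex_minus zb bx bO)/MA => //; apply: ltn_trans bx.
Qed.

(** Increasing relations of [R] and [S] all lie in [A], so if either poset lacked [(y, x)], its
    separation would produce a relation or an obstruction in [A]. *)
Let D_unblocked (x y : 'I_n) : x < y -> ~ A x y -> ~ blocked O A x y -> D y x.
Proof.
move=> xy nA nB.
have sub (T : relation_on n) : (forall u v, (u, v) \in T -> u <= v -> (u, v) \in U) ->
    separated O T -> (y, x) \in T.
  move=> TU /(_ _ _ xy) sT; apply/negPn/negP => yxT.
  have nT : (x, y) \notin T.
    by apply/negP => h; apply/nA/AU/TU; rewrite ?(ltnW xy).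
  have AT u v : u < v -> (u, v) \in T -> A u v.
    by move=> uv h; apply/AU/TU; rewrite ?(ltnW uv).
  case: (sT nT yxT) => [[b [h1 h2 bO h]]|[b [h1 h2 bO h]]|[u [v [h uO vO uv]]]]; apply: nB.
  - by constructor 1; exists b; split=> //; apply: AT.
  - by constructor 2; exists b; split=> //; apply: AT.
  - by constructor 3; exists u, v; case: h => *; split=> //; apply: AT.
case: axR axS => _ _ sR [_ _ sS].
by apply/andP; split; apply: sub => // u v uv le; apply/UP; auto.
Qed.

(** By contraposition: if [A] neither contains [(a, c)] nor blocks [(c, a)], then [(c, a)] lies in
    [D] and survives [tdd]. *)
Lemma meetT_separated : separated O M.
Proof.
move=> a c ac nac nca.
have {nac} nac : ~ A a c by move=> h; rewrite AM in nac.
case: (blocked_dec O A a c) => [|nB].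
  by apply: blocked_sub => x y; apply: AM.
case/negP: nca; apply/meetTP; split.
  by rewrite M0_lt //; apply: D_unblocked.
move=> i j ic aj.
case: (ltngtP j c) => [jc|cj|/val_inj jc]; last by rewrite jc in aj.
  case: (ltngtP a i) => [ai|ia|/val_inj ai]; last by rewrite -ai in ic.
    case: (ltngtP j i) => [ji|ij|/val_inj ->]; last by rewrite /M0 A_refl.
      (* A relation or an obstruction between [j] and [i] would extend, along the chains from [a] to
         [j] and from [i] to [c], to one between [a] and [c]. *)
      rewrite M0_lt //; apply: D_unblocked => // [ji'|].
        by apply: nac; apply: A_trans aj (A_trans ji' ic).
      have aj' := A_le aj; have ic' := A_le ic.
      case=> [[b [h1 h2 bO h]]|[b [h1 h2 bO h]]|[x [y [[h1 h2 h3] xO yO xy]]]]; apply: nB.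
      - constructor 1; exists b; split=> //; last exact: A_trans h.
          exact: leq_ltn_trans h1.
        exact: leq_trans ic'.
      - constructor 2; exists b; split=> //; last exact: A_trans ic.
          exact: leq_ltn_trans h1.
        exact: leq_trans ic'.
      constructor 3; exists x, y; split=> //; split=> //.
        exact: leq_ltn_trans h1.
      exact: leq_trans ic'.
    case: (interior ai (ltn_trans ij jc)) => iO.
      case: nB; constructor 2; exists i; split=> //; exact: ltn_trans ij jc.
    by rewrite /M0 (A_convex_minus ai ij).
  case: (interior ia ac) => aO.
    by rewrite /M0 (A_trans (A_convex_plus ia ac aO ic) aj).
  by case: nac; apply: A_convex_minus ia ac aO ic.
case: (interior ac cj) => cO; first by case: nac; apply: A_convex_plus ac cj cO aj.
by rewrite /M0 (A_trans ic (A_convex_minus ac cj cO aj)).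
Qed.

End Meet.

Lemma PEP_meet O R S : covering O -> PEP O R -> PEP O S -> PEP O (meetT R S).
Proof.
move=> hO /PEP_axiomsP aR /PEP_axiomsP aS; apply/PEP_axiomsP; split.
- by case: aR aS => pR _ _ [pS _ _]; apply: meetT_poset.
- exact: meetT_convex.
- exact: meetT_separated.
Qed.

(** * Edge reversal and closure under join *)

Definition flip O := Orientation (Ominus O) (Oplus O).

(** Reversing all edges exchanges parent and child slots, and leaves branches unchanged since they
    depend only on adjacency. *)
Lemma PEP_opp O R : PEP O R -> PEP (flip O) (opp R).
Proof.
case=> -[e ps cs tr p1 p2 p3 p4 p5 p6 p7 p8] ->.
pose e' : rel 'I_n := fun u v => e v u.
have E : adjacent e' =2 adjacent e by move=> u v; apply: orbC.
have B v u : branch e' v u = branch e v u.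
  apply/setP => w; rewrite !inE; apply: eq_connect => x y /=.
  by rewrite -/(adjacent e' x y) E.
have tr' : directed_tree e'.
  case: tr => asym conn acyc; split=> [u v|u v|c sc]; first exact: asym.
    by rewrite (eq_connect E).
  by rewrite /ucycle (eq_cycle E); apply: acyc.
have q5 v u : e' v u -> cs v u = Left -> forall w, w \in branch e' v u -> w < v.
  by rewrite B; apply: p7.
have q6 v u : e' v u -> cs v u = Right -> forall w, w \in branch e' v u -> v < w.
  by rewrite B; apply: p8.
have q7 v u : e' u v -> ps v u = Left -> forall w, w \in branch e' v u -> w < v.
  by rewrite B; apply: p5.
have q8 v u : e' u v -> ps v u = Right -> forall w, w \in branch e' v u -> v < w.
  by rewrite B; apply: p6.
exists (@Permutree n (flip O) e' cs ps tr' p2 p1 p4 p3 q5 q6 q7 q8).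
apply/setP => -[u v]; rewrite in_opp !inE /=.
exact: (esym (connect_dir false e u v)).
Qed.

Lemma PEP_join O R S : covering O -> PEP O R -> PEP O S -> PEP O (joinT R S).
Proof.
move=> hO hR hS.
have [pR _ _] := (PEP_axiomsP O R).1 hR; have [pS _ _] := (PEP_axiomsP O S).1 hS.
have hO' : covering (flip O) by move=> v v0 vn; rewrite setUC; apply: hO.
have := PEP_opp (PEP_meet hO' (PEP_opp hR) (PEP_opp hS)).
(* Destructing [O] makes [flip (flip O)] convertible to [O]. *)
by rewrite joinT_opp //; case: (O).
Qed.

End Characterization.

Theorem theorem90 (n : nat) (O : orientation n) (hO : covering O) :
  induces_sublattice (PEP O).
Proof.
split=> [R /PEP_axiomsP[]//|R S|R S]; first exact: PEP_meet.
exact: PEP_join.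
Qed.
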